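(* Let $f:\mathbb{R}^N\to\mathbb{R}$ be strictly convex, self-concordant with constant $2$ and bounded below so that a minimizer exists. Suppose that the sequence $(x_k)_{k\in\mathbb{N}}$ is generated by the algorithm SIGMA and that the coarse direction $\hat d_k$ is employed (so that $\hat\lambda(x_k)>\mu\lambda(x_k)$ and $\hat\lambda(x_k)>\nu$). Write $\varepsilon:=\sqrt{1-\mu^2}$. For any $\mu\in(0,1)$ there exist constants $\gamma>0$ and $\eta\in\left(0,\frac{3-\sqrt5}{2}\right)$ such that: (i) if $\hat\lambda(x_k)>\eta$, then $f(x_{k+1})-f(x_k)\le-\gamma$; (ii) if $\hat\lambda(x_k)\le\eta$, then SIGMA selects the unit step $t_k=1$ and $$\hat\lambda(x_{k+1})<\left(\frac{\hat\lambda(x_k)}{1-\hat\lambda(x_k)}\right)^2<\hat\lambda(x_k),$$ and furthermore $$\lambda(x_{k+1})<\frac{\varepsilon+\hat\lambda(x_k)}{(1-\hat\lambda(x_k))^2}\,\lambda(x_k)<\lambda(x_k).$$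
   Context: Self-concordance with constant $2$: $f$ is three times differentiable, convex, and for all $x,u\in\mathbb{R}^N$ the function $\phi(t)=f(x+tu)$ satisfies $|\phi'''(t)|\le 2\phi''(t)^{3/2}$. Strict convexity is used in the sense that $\nabla^2f(x)$ is positive definite. Operators: $n\le N$, $P\in\mathbb{R}^{N\times n}$ is a fixed matrix with full column rank $n$, and $R=P^T$. Reduced Hessian: $Q_H(x):=R\nabla^2f(x)P$. Coarse direction: $\hat d_k:=-P[Q_H(x_k)]^{-1}R\nabla f(x_k)$. Fine (Newton) direction: $d_{h,k}:=-[\nabla^2f(x_k)]^{-1}\nabla f(x_k)$. Approximate decrement: $\hat\lambda(x):=\left[(R\nabla f(x))^T[Q_H(x)]^{-1}R\nabla f(x)\right]^{1/2}$. Newton decrement: $\lambda(x):=\left[\nabla f(x)^T[\nabla^2f(x)]^{-1}\nabla f(x)\right]^{1/2}$. Algorithm SIGMA: inputs $\mu\in(0,1)$, $\alpha\in(0,0.5)$, $\beta\in(0,1)$, $\nu\in(0,0.68^2)$, tolerance $\epsilon\in(\nu,0.68^2)$ and $x_0\in\mathbb{R}^N$. At iteration $k$, set the direction $d_k$ equal to the coarse direction $\hat d_k$ if $\hat\lambda(x_k)>\mu\lambda(x_k)$ and $\hat\lambda(x_k)>\nu$, and to the Newton direction $d_{h,k}$ otherwise. Stop if $-\langle\nabla f(x_k),d_k\rangle\le\epsilon$. Otherwise determine $t_k$ by backtracking: start from $t_k=1$ and, while $f(x_k+t_kd_k)>f(x_k)+\alpha t_k\nabla f(x_k)^Td_k$,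 replace $t_k$ by $\beta t_k$. Set $x_{k+1}=x_k+t_kd_k$. *)

(* Defs.v *)
From HB Require Import structures.
From mathcomp Require Import all_boot all_order all_algebra.
From mathcomp Require Import all_classical all_reals all_analysis.
Import Order.TTheory GRing.Theory Num.Theory.
Import numFieldNormedType.Exports.

Set Implicit Arguments.
Unset Strict Implicit.
Unset Printing Implicit Defensive.

Local Open Scope classical_set_scope.
Local Open Scope ring_scope.

Section Calculus.
Variables (R : realType) (N : nat).
Implicit Types (f : 'cV[R]_N -> R) (x u v : 'cV[R]_N).

Definition dotp u v : R := (u^T *m v) 0 0.

Definition gradient f x : 'cV[R]_N := \col_i 'D_(delta_mx i 0) f x.

Definition hessian f x : 'M[R]_N :=
  \matrix_(i, j) 'D_(delta_mx j 0) (fun y => gradient f y i 0) x.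

(* Frechet differentiability of f, of its gradient and of its Hessian on the
   whole space. *)
Definition thrice_differentiable f : Prop :=
  [/\ forall x, differentiable f x,
      forall x, differentiable (gradient f) x
    & forall x, differentiable (hessian f) x].

(* Strict convexity in the sense that every Hessian is positive definite. *)
Definition hessian_posdef f : Prop :=
  forall x u, u != 0 -> 0 < dotp u (hessian f x *m u).

(* Convexity makes the base of the real power [`^] nonnegative here. *)
Definition self_concordant f : Prop :=
  [/\ thrice_differentiable f,
      convex_function [set: 'cV[R]_N] f
    & forall x u (s : R),
        let phi := fun t : R => f (x + t *: u) in
        `|derive1n 3 phi s| <= 2 * (derive1n 2 phi s) `^ (3 / 2)].

Definition bounded_below f : Prop := exists m : R, forall x, m <= f x.

Definition has_minimizer f : Prop := exists xs, forall x, f xs <= f x.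

End Calculus.

Section Multilevel.
Variables (R : realType) (N n : nat) (P : 'M[R]_(N, n)) (f : 'cV[R]_N -> R).
Implicit Types (x d : 'cV[R]_N).

(* [P^T] plays the role of the restriction operator. *)
Definition reduced_gradient x : 'cV[R]_n := P^T *m gradient f x.

Definition reduced_hessian x : 'M[R]_n := P^T *m hessian f x *m P.

Definition coarse_direction x : 'cV[R]_N :=
  - (P *m (invmx (reduced_hessian x) *m reduced_gradient x)).

Definition newton_direction x : 'cV[R]_N :=
  - (invmx (hessian f x) *m gradient f x).

Definition approximate_decrement x : R :=
  Num.sqrt (dotp (reduced_gradient x)
                 (invmx (reduced_hessian x) *m reduced_gradient x)).

Definition newton_decrement x : R :=
  Num.sqrt (dotp (gradient f x) (invmx (hessian f x) *m gradient f x)).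

Variables (mu alpha beta nu tol : R).

Definition coarse_employed x : bool :=
  (mu * newton_decrement x < approximate_decrement x) &&
  (nu < approximate_decrement x).

Definition sigma_direction x : 'cV[R]_N :=
  if coarse_employed x then coarse_direction x else newton_direction x.

Definition sigma_stops x : bool :=
  - dotp (gradient f x) (sigma_direction x) <= tol.

Definition sufficient_decrease x d (t : R) : bool :=
  f (x + t *: d) <= f x + alpha * t * dotp (gradient f x) d.

(* The trial steps are 1, beta, beta^2, ...; the loop returns the first one
   giving sufficient decrease. *)
Definition backtracking_step x d (t : R) : Prop :=
  exists m : nat,
    [/\ t = beta ^+ m, sufficient_decrease x d t
      & forall j : nat, (j < m)%N -> ~~ sufficient_decrease x d (beta ^+ j)].

(* x_0, ..., x_K and t_0, ..., t_(K-1) are the iterates and the step lengths of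
   the first K iterations, none of which triggers the stopping test.  The values
   x k for k > K and t k for k >= K are irrelevant. *)
Definition sigma_run (x0 : 'cV[R]_N) (K : nat)
    (x : nat -> 'cV[R]_N) (t : nat -> R) : Prop :=
  x 0%N = x0 /\
  forall k : nat, (k < K)%N ->
    [/\ ~~ sigma_stops (x k),
        backtracking_step (x k) (sigma_direction (x k)) (t k)
      & x k.+1 = x k + t k *: sigma_direction (x k)].

End Multilevel.

(* Main.v *)
(* Along a line, self-concordance makes phi''^(-1/2) 1-Lipschitz.  By Banach's
   theorem on symmetric trilinear forms, |D^3 f(x)[u,v,v]| <= 2 |u|_x |v|_x^2 for
   the local norm |u|_x = (u^T hess f(x) u)^(1/2), so that for a step d with
   r = |d|_x < 1 the Hessian at x + s d is squeezed between (1 - s r)^2 and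
   (1 - s r)^(-2) times the Hessian at x.

   For the coarse direction d one has |d|_x = lhat(x), and the linearised gradient
   grad f(x) + hess f(x) d vanishes on the range of P; integrating the Hessian
   bound gives |<z, grad f(x + d)>| <= r^2 / (1 - r) |z|_x there, and passing to
   the norm at x + d costs another factor 1 / (1 - r).  The two inequalities cannot
   be sharp together: the first needs z parallel to d with the Hessian growing along d,
   the second needs it to shrink along z.  On all of R^N the linearised
   gradient has dual norm sqrt (lambda^2 - lhat^2) < eps lambda, by Pythagoras.

   The decrease of f comes from f(x + s d) <= f(x) - s r^2 + s^2 r^2 / 2 + s^3 r^3
   for s r <= 1/2, which shows that the backtracking accepts every
   s <= 1 / (2 (1 + r)), and s = 1 when r <= 1/2 - alpha. *)
Require Import Defs.
From HB Require Import structures.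
From mathcomp Require Import all_boot all_order all_algebra.
From mathcomp Require Import all_classical all_reals all_analysis.
From mathcomp Require Import ring lra.
Import Order.TTheory GRing.Theory Num.Theory.
Import numFieldNormedType.Exports.

Set Implicit Arguments.
Unset Strict Implicit.
Unset Printing Implicit Defensive.

Local Open Scope ring_scope.

(** * Symmetric forms *)

Section TrilinearForms.
Variables (R : realType).

(** Take the cosine and sine of [acos a / 3]; both equations are triple-angle formulas. *)
Lemma trisected_point (a : R) : -1 <= a <= 1 ->
  exists c s : R, [/\ c ^+ 2 + s ^+ 2 = 1, a = 4 * c ^+ 3 - 3 * c
    & Num.sqrt (1 - a ^+ 2) = 3 * s - 4 * s ^+ 3].
Proof.
move=> ha; pose th := acos a / 3.
have th3 : acos a = th + th + th by rewrite /th; field.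
have cs : cos th ^+ 2 + sin th ^+ 2 = 1 := cos2Dsin2 th.
have s2 : sin th ^+ 2 = 1 - cos th ^+ 2 by rewrite -cs addrC addKr.
exists (cos th), (sin th); split=> //.
- by rewrite -(@acosK _ a) // th3 !(cosD, sinD); ring: s2.
- by rewrite -sin_acos // th3 !(cosD, sinD); ring: s2.
Qed.

Definition cubic_form (A B C D c s : R) : R :=
  c ^+ 3 * A + 3 * (c ^+ 2 * s) * B + 3 * (c * s ^+ 2) * C + s ^+ 3 * D.

(* M. Riesz's interpolation formula in degree three: the value at 0 of
   [p cos alpha + p' (sin alpha) / 3], for the trigonometric polynomial
   [p t = cubic_form A B C D (cos t) (sin t)], is a convex combination of the
   values of [p] at the points [alpha / 3 + 2 k pi / 3]. *)
Lemma cubic_form_bound (A B C D a m : R) : -1 <= a <= 1 ->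
  (forall c s, c ^+ 2 + s ^+ 2 = 1 -> `|cubic_form A B C D c s| <= m) ->
  `|a * A + Num.sqrt (1 - a ^+ 2) * B| <= m.
Proof.
move=> ha hp; have [c [s [cs -> ->]]] := trisected_point ha.
pose q : R := Num.sqrt 3; have q2 : q ^+ 2 = 3 by rewrite sqr_sqrtr.
have s2 : s ^+ 2 = 1 - c ^+ 2 by rewrite -cs addrC addKr.
(* [(c1, s1)] and [(c2, s2')] are the point [(c, s)] of the circle rotated by 2 pi / 3 and by - 2 pi
   / 3. *)
pose c1 := - c / 2 - q * s / 2; pose s1 := q * c / 2 - s / 2.
pose c2 := - c / 2 + q * s / 2; pose s2' := - q * c / 2 - s / 2.
have cs1 : c1 ^+ 2 + s1 ^+ 2 = 1 by rewrite /c1 /s1; field: s2 q2.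
have cs2 : c2 ^+ 2 + s2' ^+ 2 = 1 by rewrite /c2 /s2'; field: s2 q2.
(* At z = cos t this is (sin 3t / (3 sin t))^2, a Fejér-type weight. *)
pose w (z : R) := (4 * z ^+ 2 - 1) ^+ 2 / 9.
have w0 z : 0 <= w z by rewrite /w divr_ge0 // sqr_ge0.
have w1 : w c + w c1 + w c2 = 1 by rewrite /w /c1 /c2; field: s2 q2.
have -> : (4 * c ^+ 3 - 3 * c) * A + (3 * s - 4 * s ^+ 3) * B =
    w c * cubic_form A B C D c s + w c1 * cubic_form A B C D c1 s1
    + w c2 * cubic_form A B C D c2 s2'.
  by rewrite /w /cubic_form /c1 /c2 /s1 /s2'; field: s2 q2.
apply: (le_trans (ler_normD _ _)).
apply: (le_trans (lerD (ler_normD _ _) (lexx _))).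
have wle z y : z ^+ 2 + y ^+ 2 = 1 ->
  `|w z * cubic_form A B C D z y| <= w z * m.
  by move=> zy; rewrite normrM ger0_norm // ler_wpM2l // hp.
rewrite -[m]mul1r -w1 !mulrDl.
by rewrite !lerD // wle.
Qed.

Variable V : lmodType R.
Implicit Types (Q E : V -> V -> R) (T : V -> V -> V -> R) (u v w z d : V).

Definition symmetric_bilinear Q :=
  (forall u v, Q u v = Q v u) /\
  (forall a u v w, Q (a *: u + v) w = a * Q u w + Q v w).

Definition symmetric_trilinear T :=
  [/\ forall u v w, T u v w = T v u w, forall u v w, T u v w = T u w v &
    forall a u u' v w, T (a *: u + u') v w = a * T u v w + T u' v w].

Definition positive_definite Q := forall u, u != 0 -> 0 < Q u u.

Definition form_norm Q u := Num.sqrt (Q u u).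

Lemma bilinear0l Q w : symmetric_bilinear Q -> Q 0 w = 0.
Proof.
move=> [_ lQ]; have := lQ 1 0 0 w; rewrite scale1r addr0 mul1r => h.
by apply: (addrI (Q 0 w)); rewrite addr0 -h.
Qed.

Lemma bilinearZl Q c u w : symmetric_bilinear Q -> Q (c *: u) w = c * Q u w.
Proof. by move=> bQ; rewrite -[c *: u]addr0 (proj2 bQ) bilinear0l // addr0. Qed.

Lemma bilinear_expand Q a b u v : symmetric_bilinear Q ->
  Q (a *: u + b *: v) (a *: u + b *: v) =
  a ^+ 2 * Q u u + 2 * (a * b) * Q u v + b ^+ 2 * Q v v.
Proof.
move=> bQ; have [sQ lQ] := bQ.
rewrite lQ bilinearZl // ![Q _ (_ + _)]sQ !lQ !bilinearZl // (sQ v u); ring.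
Qed.

Lemma form_normZ Q a u : symmetric_bilinear Q ->
  form_norm Q (a *: u) = `|a| * form_norm Q u.
Proof.
move=> bQ; rewrite /form_norm bilinearZl // (proj1 bQ) bilinearZl // mulrA -expr2.
by rewrite sqrtrM ?sqr_ge0 // sqrtr_sqr.
Qed.

Lemma form_norm_ge0 Q u : 0 <= form_norm Q u.
Proof. exact: sqrtr_ge0. Qed.

Section Bounds.
Variable Q : V -> V -> R.
Hypotheses (bQ : symmetric_bilinear Q) (pQ : positive_definite Q).

Lemma form_ge0 u : 0 <= Q u u.
Proof.
have [->|/pQ/ltW//] := eqVneq u 0.
by rewrite bilinear0l.
Qed.

Lemma form_normK u : form_norm Q u ^+ 2 = Q u u.
Proof. by rewrite sqr_sqrtr // form_ge0. Qed.

Lemma form_norm_gt0 u : u != 0 -> 0 < form_norm Q u.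
Proof. by move=> u0; rewrite sqrtr_gt0 pQ. Qed.

Lemma form_norm_eq0 u : form_norm Q u = 0 -> u = 0.
Proof. by move=> h; apply/eqP; apply: contra_eqT h => /form_norm_gt0/gt_eqF->. Qed.

(** Scaling [z] by the norm of [d] and [d] by the norm of [z] makes them equally long; then [hi]
    bounds [E] on their sum and [lo] on their difference. The term [Q z d] is kept so that the case
    of equality can be read off later. *)
Lemma polarization_bound E (lo hi : R) z d : symmetric_bilinear E ->
    (forall u, lo * Q u u <= E u u <= hi * Q u u) -> z != 0 -> d != 0 ->
  E z d <= (hi * (form_norm Q z * form_norm Q d + Q z d)
            - lo * (form_norm Q z * form_norm Q d - Q z d)) / 2.
Proof.
move=> bE hE z0 d0; set a := form_norm Q z; set b := form_norm Q d.
have a0 : 0 < a by exact: form_norm_gt0.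
have b0 : 0 < b by exact: form_norm_gt0.
have /andP[_] := hE (b *: z + a *: d); have /andP[+ _] := hE (b *: z + (- a) *: d).
rewrite !bilinear_expand // -!form_normK -/a -/b => h1 h2.
have ab : 0 < 4 * (a * b) by rewrite !mulr_gt0.
rewrite -(ler_pM2l ab); nra.
Qed.

Lemma cauchy_schwarz u v : `|Q u v| <= form_norm Q u * form_norm Q v.
Proof.
have [->|u0] := eqVneq u 0.
  by rewrite bilinear0l // normr0 mulr_ge0 ?form_norm_ge0.
have [->|v0] := eqVneq v 0.
  by rewrite (proj1 bQ) bilinear0l // normr0 mulr_ge0 ?form_norm_ge0.
have a0 := form_norm_gt0 u0; have b0 := form_norm_gt0 v0.
have ab : 0 < 2 * (form_norm Q u * form_norm Q v) by rewrite !mulr_gt0.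
have := form_ge0 (form_norm Q v *: u + form_norm Q u *: v).
have := form_ge0 (form_norm Q v *: u + (- form_norm Q u) *: v).
rewrite !bilinear_expand // -!form_normK => h1 h2.
by rewrite ler_norml; apply/andP; split; rewrite -(ler_pM2l ab); nra.
Qed.

Lemma trilinear0l T v w : symmetric_trilinear T -> T 0 v w = 0.
Proof.
move=> [_ _ lT]; have := lT 1 0 0 v w; rewrite scale1r addr0 mul1r => h.
by apply: (addrI (T 0 v w)); rewrite addr0 -h.
Qed.

Lemma trilinearZl T a u v w : symmetric_trilinear T ->
  T (a *: u) v w = a * T u v w.
Proof.
by move=> bT; have [_ _ lT] := bT; rewrite -[a *: u]addr0 lT trilinear0l // addr0.
Qed.

Lemma trilinear_expand T x y v e : symmetric_trilinear T ->
  T (x *: v + y *: e) (x *: v + y *: e) (x *: v + y *: e) =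
  cubic_form (T v v v) (T e v v) (T e e v) (T e e e) x y.
Proof.
move=> bT; have [sT1 sT2 lT] := bT.
have lT2 a u v' w z : T z (a *: u + v') w = a * T z u w + T z v' w.
  by rewrite sT1 lT ![T z _ _]sT1.
have lT3 a u v' w z : T z w (a *: u + v') = a * T z w u + T z w v'.
  by rewrite sT2 lT2 ![T z w _]sT2.
have lZ a u w z : T (a *: u) w z = a * T u w z by exact: trilinearZl.
have lZ2 a u w z : T w (a *: u) z = a * T w u z by rewrite sT1 lZ sT1.
have lZ3 a u w z : T w z (a *: u) = a * T w z u by rewrite sT2 lZ2 sT2.
rewrite !(lT, lT2, lT3, lZ, lZ2, lZ3).
rewrite (sT2 v v e) (sT1 v e v) (sT2 e v e) (sT1 v e e) (sT2 e v e).
rewrite /cubic_form; ring.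
Qed.

(* Banach: on a Euclidean space a symmetric trilinear form has the same norm
   as its restriction to the diagonal. *)
Lemma trilinear_bound T (m : R) u v : symmetric_trilinear T ->
    (forall w, `|T w w w| <= m * form_norm Q w ^+ 3) ->
  `|T u v v| <= m * (form_norm Q u * form_norm Q v ^+ 2).
Proof.
move=> bT; have [sT1 sT2 lT] := bT => hT.
have T0 z w : T 0 z w = 0 by exact: trilinear0l.
have lZ a z w w' : T (a *: z) w w' = a * T z w w' by exact: trilinearZl.
have lZ2 a z w w' : T w (a *: z) w' = a * T w z w' by rewrite sT1 lZ sT1.
have lZ3 a z w w' : T w w' (a *: z) = a * T w w' z by rewrite sT2 lZ2 sT2.
have [->|u0] := eqVneq u 0.
  by rewrite T0 normr0 /form_norm bilinear0l // sqrtr0 mul0r mulr0.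
have [->|v0] := eqVneq v 0.
  by rewrite sT1 T0 normr0 /form_norm bilinear0l // sqrtr0 expr0n !mulr0.
have nu0 := form_norm_gt0 u0; have nv0 := form_norm_gt0 v0.
(* Homogeneity reduces the claim to unit vectors. *)
wlog [nu1 nv1] : u v u0 v0 nu0 nv0 / form_norm Q u = 1 /\ form_norm Q v = 1.
  pose u' := (form_norm Q u)^-1 *: u; pose v' := (form_norm Q v)^-1 *: v.
  have nu' : form_norm Q u' = 1.
    by rewrite form_normZ // ger0_norm ?invr_ge0 ?form_norm_ge0 // mulVf // gt_eqF.
  have nv' : form_norm Q v' = 1.
    by rewrite form_normZ // ger0_norm ?invr_ge0 ?form_norm_ge0 // mulVf // gt_eqF.
  have u'0 : u' != 0 by rewrite scaler_eq0 invr_eq0 (gt_eqF nu0).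
  have v'0 : v' != 0 by rewrite scaler_eq0 invr_eq0 (gt_eqF nv0).
  move=> /(_ u' v' u'0 v'0); rewrite nu' nv' => /(_ ltr01 ltr01 (conj erefl erefl)).
  rewrite expr1n !mulr1 => h.
  have -> : T u v v = form_norm Q u * form_norm Q v ^+ 2 * T u' v' v'.
    by rewrite /u' /v' lZ lZ2 lZ3; field; rewrite !gt_eqF.
  have c0 : 0 <= form_norm Q u * form_norm Q v ^+ 2 by rewrite mulr_ge0 ?sqr_ge0 ?ltW.
  by rewrite normrM ger0_norm // mulrC ler_wpM2r.
rewrite nu1 nv1 expr1n !mulr1.
have Quu : Q u u = 1 by rewrite -form_normK nu1 expr1n.
have Qvv : Q v v = 1 by rewrite -form_normK nv1 expr1n.
pose a := Q v u; have ha : -1 <= a <= 1.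
  by rewrite -ler_norml; have := cauchy_schwarz v u; rewrite nu1 nv1 mulr1.
have a2 : 0 <= 1 - a ^+ 2 by case/andP: ha => *; nra.
pose b := Num.sqrt (1 - a ^+ 2); have b2 : b ^+ 2 = 1 - a ^+ 2 by rewrite sqr_sqrtr.
(* [r] is the component of [u] orthogonal to [v], and [e] below is its normalization. If [b = 0]
   then [b^-1 = 0] and [e = 0], which is why only [Q e e <= 1] is proved. *)
pose r := 1 *: u + (- a) *: v.
have Qrr : Q r r = b ^+ 2.
  by rewrite bilinear_expand // Quu Qvv b2 (proj1 bQ) -/a; ring.
have Qvr : Q v r = 0.
  by rewrite (proj1 bQ) (proj2 bQ) bilinearZl // Qvv (proj1 bQ) -/a; ring.
pose e := b^-1 *: r.
have ue : u = a *: v + b *: e.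
  have r0 : b = 0 -> r = 0.
    by move=> b0; apply: form_norm_eq0; rewrite /form_norm Qrr b0 expr0n sqrtr0.
  have -> : b *: e = r.
    have [/[dup] b0 /r0 ->|b0] := eqVneq b 0; first by rewrite b0 scale0r.
    by rewrite scalerA divff // scale1r.
  by rewrite /r scale1r addrC scaleNr subrK.
(* On the span of [v] and [e] the diagonal of [T] is a cubic form bounded by [m] on the unit circle,
   and [T u v v] is the combination of its first two coefficients that Riesz's formula controls. *)
have := @cubic_form_bound (T v v v) (T e v v) (T e e v) (T e e e) a m ha.
have -> : T u v v = a * T v v v + b * T e v v by rewrite [in LHS]ue lT lZ.
apply=> c s cs; rewrite -trilinear_expand //.
apply: (le_trans (hT _)); rewrite ler_piMr //.
  by have := hT v; rewrite nv1 expr1n mulr1; exact: le_trans.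
rewrite exprn_ile1 ?form_norm_ge0 // -sqrtr1 ler_wsqrtr //.
have Qve : Q v e = 0 by rewrite (proj1 bQ) bilinearZl // (proj1 bQ) Qvr mulr0.
have Qee : Q e e <= 1.
  rewrite bilinearZl // (proj1 bQ) bilinearZl // Qrr.
  have [->|b0] := eqVneq b 0; first by rewrite invr0 !mul0r.
  by rewrite mulrA -expr2 exprVn mulVf // expf_neq0.
by rewrite bilinear_expand // Qvv Qve; nra.
Qed.

End Bounds.

End TrilinearForms.

(** * Monotonicity and symmetry of second derivatives *)

Section RealFunctions.
Variable R : realType.

Lemma mean_value (F F' : R -> R) (a b : R) : a < b ->
    (forall s, a <= s <= b -> is_derive s 1 F (F' s)) ->
  exists2 c, a < c < b & F b - F a = F' c * (b - a).
Proof.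
move=> ab dF.
have [||c cab Fc] := @MVT R F F' a b ab.
- by move=> s; rewrite in_itv /= => /andP[/ltW as_ /ltW sb]; apply: dF; rewrite as_.
- by apply: derivable_within_continuous => s; rewrite in_itv /= => /dF[].
by exists c => //; rewrite in_itv in cab.
Qed.

Lemma nondecreasing_of_derive (F F' : R -> R) (a b : R) : a <= b ->
    (forall s, a <= s <= b -> is_derive s 1 F (F' s)) ->
    (forall s, a <= s <= b -> 0 <= F' s) ->
  F a <= F b.
Proof.
rewrite le_eqVlt => /predU1P[-> //|ab] dF F'0.
have [c /andP[ac cb] Fc] := mean_value ab dF.
by rewrite -subr_ge0 Fc mulr_ge0 // ?F'0 ?(ltW ac) ?(ltW cb) // subr_ge0 ltW.
Qed.

(** Monotonicity and [F b <= F a] make [F] constant on the interval, so [c] is an interior maximum.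
    This serves the equality case in [gradient_line_lt]. *)
Lemma derive_eq0_of_nondecreasing (F F' : R -> R) (a b c : R) : a < c < b ->
    (forall s, a <= s <= b -> is_derive s 1 F (F' s)) ->
    (forall s, a <= s <= b -> 0 <= F' s) ->
  F b <= F a -> F' c = 0.
Proof.
move=> /andP[ac cb] dF F'0 Fba.
have Fcst s : a <= s <= b -> F s = F a.
  move=> /andP[as_ sb]; apply/eqP; rewrite eq_le; apply/andP; split.
    apply: le_trans Fba; apply: (nondecreasing_of_derive sb) => y /andP[sy yb].
      by apply: dF; rewrite yb (le_trans as_).
    by apply: F'0; rewrite yb (le_trans as_).
  apply: (nondecreasing_of_derive as_) => y /andP[ay ys].
    by apply: dF; rewrite ay (le_trans ys).
  by apply: F'0; rewrite ay (le_trans ys).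
have cab : a <= c <= b by rewrite !ltW.
have [_ <-] := dF _ cab.
suff [_ ->] : is_derive c (1 : R) F 0 by [].
apply: (@derive1_at_max _ F a b c).
- by rewrite ltW // (lt_trans ac).
- move=> t; rewrite in_itv /= => /andP[/ltW at_ /ltW tb].
  by apply: ex_derive; apply: dF; rewrite at_.
- by rewrite in_itv /= ac.
- by move=> t; rewrite in_itv /= => /andP[/ltW at_ /ltW tb]; rewrite !Fcst // at_.
Qed.

End RealFunctions.

(** * Young's theorem on mixed derivatives *)

Section Young.
Variables (R : realType) (V : normedModType R).

Lemma is_derive_line (W : normedModType R) (g : V -> W) (x d : V) (s : R) l :
  is_derive (x + s *: d) d g l -> is_derive s 1 (fun t : R => g (x + t *: d)) l.
Proof.
have eq_quot : (fun h : R => h^-1 *: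
      (((fun t : R => g (x + t *: d)) \o shift s) (h *: 1) - g (x + s *: d)))
  = (fun h : R => h^-1 *: ((g \o shift (x + s *: d)) (h *: d) - g (x + s *: d))).
  apply/funext => h /=; congr (_ *: (g _ - _)).
  by rewrite [h *: 1]mulr1 scalerDl addrCA.
move=> [dg dgl]; split; rewrite /derivable /derive eq_quot.
  exact: dg.
exact: dgl.
Qed.

Definition second_difference (g : V -> R) (x u v : V) (h : R) : R :=
  g (x + h *: v + h *: u) - g (x + h *: u) - g (x + h *: v) + g x.

(** By the mean value theorem along [u], the second difference is [h] times an increment of ['D_u g]
    by [h *: v] near [x]; the first-order expansion of ['D_u g] at [x], used at both ends, evaluates
    that increment. *)
Lemma second_difference_approx (g : V -> R) (x u v : V) :
    (forall y, derivable g y u) -> differentiable ('D_u g) x ->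
  forall e, 0 < e -> exists2 delta, 0 < delta & forall h, 0 < h < delta ->
    `|second_difference g x u v h - h ^+ 2 * 'd ('D_u g) x v| <= e * h ^+ 2.
Proof.
move=> gu dp e e0; set p := 'D_u g in dp *.
(* [h * M] dominates the total length of the two displacements [h *: v + c *: u] and [c *: u]; the
   summand 1 keeps [M] positive. *)
pose M := 2 * `|u| + `|v| + 1; have M0 : 0 < M by rewrite ltr_wpDl ?addr_ge0 ?mulr_ge0.
have e'0 : 0 < e / M by rewrite divr_gt0.
have := diff_locally dp => /eqaddoP /(_ _ e'0) /nbhs_ballP[delta /= delta0 hdelta].
have {}hdelta y : `|y| < delta -> `|p (x + y) - p x - 'd p x y| <= e / M * `|y|.
  move=> yd; have := hdelta y; rewrite -ball_normE /= sub0r normrN => /(_ yd).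
  by rewrite -![(_ - _ : _ -> _) _]/(_ - _) /= [x + y]addrC opprD addrA.
exists (delta / M) => [|h /andP[h0 hd]]; first by rewrite divr_gt0.
pose G (s : R) := g (x + h *: v + s *: u) - g (x + s *: u).
have dG (s : R) : 0 <= s <= h ->
    is_derive s 1 G (p (x + h *: v + s *: u) - p (x + s *: u)).
  by move=> _; apply: is_deriveB; apply: is_derive_line; exact: derivableP.
have [c /andP[c0 ch] Gc] := mean_value h0 dG.
have -> : second_difference g x u v h = G h - G 0.
  by rewrite /G /second_difference !scale0r !addr0; ring.
rewrite {}Gc subr0.
have hM : h * M < delta by rewrite -ltr_pdivlMr.
have n2 : `|c *: u| <= h * `|u|.
  by rewrite normrZ (gtr0_norm c0) ler_wpM2r // ltW.
have n1 : `|h *: v + c *: u| <= h * (`|u| + `|v|).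
  by rewrite (le_trans (ler_normD _ _)) // normrZ (gtr0_norm h0) mulrDr addrC lerD2r.
have nu := normr_ge0 u; have nv := normr_ge0 v.
have d1 := hdelta (h *: v + c *: u) _; have {}d1 := d1 (le_lt_trans n1 _).
have d2 := hdelta (c *: u) _; have {}d2 := d2 (le_lt_trans n2 _).
have {}d1 := d1 ltac:(by rewrite /M in hM; nra).
have {}d2 := d2 ltac:(by rewrite /M in hM; nra).
rewrite addrA linearD linearZ /= -/(_ *: _) in d1.
rewrite [_ *: 'd p x v]/(_ * _) in d1.
set P1 := p (x + h *: v + c *: u) in d1 *; set P2 := p (x + c *: u) in d2 *.
set L1 := 'd p x v in d1 *; set L2 := 'd p x (c *: u) in d1 d2.
have -> : (P1 - P2) * h - h ^+ 2 * L1 =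
    h * ((P1 - p x - (h * L1 + L2)) - (P2 - p x - L2)) by ring.
rewrite normrM (gtr0_norm h0) expr2 mulrCA ler_wpM2l ?(ltW h0) //.
apply: (le_trans (ler_normB _ _)); apply: (le_trans (lerD d1 d2)).
have -> : e * h = e / M * (h * M) by field; rewrite gt_eqF.
by rewrite -mulrDr ler_wpM2l ?(ltW e'0) // /M; nra.
Qed.

(** The second difference is symmetric in [u] and [v], and each mixed derivative times [h ^+ 2]
    approximates it up to o(h^2). *)
Lemma derive_comm (g p q : V -> R) (x u v : V) :
    (forall y, is_derive y u g (p y)) -> (forall y, is_derive y v g (q y)) ->
    differentiable p x -> differentiable q x ->
  'D_v p x = 'D_u q x.
Proof.
move=> gu gv.
have <- : 'D_u g = p by apply/funext => y; have [] := gu y.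
have <- : 'D_v g = q by apply/funext => y; have [] := gv y.
have {}gu y : derivable g y u by [].
have {}gv y : derivable g y v by [].
move=> dp dq; rewrite !deriveE //; apply/eqP; rewrite -subr_eq0 -normr_le0.
apply/ler_addgt0Pl => e e0; rewrite addr0.
have e2 : 0 < e / 2 by rewrite divr_gt0.
have [d1 d10 h1] := @second_difference_approx g x u v gu dp _ e2.
have [d2 d20 h2] := @second_difference_approx g x v u gv dq _ e2.
pose h := Num.min d1 d2 / 2.
have m0 : 0 < Num.min d1 d2 by rewrite lt_min d10.
have h0 : 0 < h by rewrite divr_gt0.
have hm : h < Num.min d1 d2 by rewrite /h; lra.
have {}h1 := h1 h; have {}h2 := h2 h; move: hm; rewrite lt_min => /andP[hd1 hd2].
rewrite h0 hd1 in h1; rewrite h0 hd2 in h2.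
have {}h1 := h1 isT; have {}h2 := h2 isT.
have sw : second_difference g x v u h = second_difference g x u v h.
  by rewrite /second_difference [x + h *: u + _]addrAC [X in X + _]addrAC.
rewrite sw in h2.
have hh : 0 < h ^+ 2 by rewrite exprn_gt0.
suff key (A B S : R) : `|S - h ^+ 2 * A| <= e / 2 * h ^+ 2 ->
    `|S - h ^+ 2 * B| <= e / 2 * h ^+ 2 -> `|A - B| <= e by exact: key h1 h2.
move=> hA hB; rewrite -(ler_pM2l hh) -{1}(gtr0_norm hh) -normrM.
have -> : h ^+ 2 * (A - B) = (S - h ^+ 2 * B) - (S - h ^+ 2 * A) by ring.
by apply: (le_trans (ler_normB _ _)); apply: (le_trans (lerD hB hA)); lra.
Qed.

End Young.

(** * Derivatives along lines *)

Section DotProduct.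
Variable R : realType.

Lemma dotpC N (u v : 'cV[R]_N) : dotp u v = dotp v u.
Proof. by rewrite /dotp -[in LHS](trmxK (u^T *m v)) trmx_mul trmxK mxE. Qed.

Lemma dotp_linearl N a (u v w : 'cV[R]_N) :
  dotp (a *: u + v) w = a * dotp u w + dotp v w.
Proof. by rewrite /dotp linearD linearZ /= mulmxDl -scalemxAl !mxE. Qed.

Lemma dotp_linearr N a (u v w : 'cV[R]_N) :
  dotp w (a *: u + v) = a * dotp w u + dotp w v.
Proof. by rewrite dotpC dotp_linearl ![dotp _ w]dotpC. Qed.

Lemma dotpDr N (u v w : 'cV[R]_N) : dotp w (u + v) = dotp w u + dotp w v.
Proof. by have := dotp_linearr 1 u v w; rewrite scale1r mul1r. Qed.

Lemma dotpNr N (u w : 'cV[R]_N) : dotp w (- u) = - dotp w u.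
Proof. by rewrite /dotp mulmxN mxE. Qed.

Lemma dotp_mulmxl M N (A : 'M[R]_(M, N)) u v : dotp (A *m u) v = dotp u (A^T *m v).
Proof. by rewrite /dotp trmx_mul mulmxA. Qed.

Section MatrixForm.
Variables (M N : nat) (v : 'cV[R]_M) (w : 'cV[R]_N).

(** Pairing a matrix with two fixed vectors is linear and continuous, so one chain rule covers both
    the Hessian and, with [w] the identity of size 1, the gradient. *)
Definition mxform (A : 'M[R]_(M, N)) : R := dotp v (A *m w).

Fact mxform_is_linear : linear mxform.
Proof.
by move=> a A B; rewrite /mxform mulmxDl -scalemxAl dotp_linearr.
Qed.

HB.instance Definition _ := GRing.isLinear.Build _ _ _ _ mxform mxform_is_linear.

Lemma mxform_continuous : continuous mxform.
Proof.
have -> : mxform = \sum_(i < M) \sum_(j < N)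
    (fun A : 'M[R]_(M, N) => A i j * (v i 0 * w j 0)).
  apply/funext => A; rewrite /mxform /dotp mxE fct_sumE; apply: eq_bigr => i _.
  rewrite fct_sumE !mxE mulr_sumr; apply: eq_bigr => j _; ring.
move=> A; apply: differentiable_continuous.
apply: differentiable_sum => i; apply: differentiable_sum => j.
apply: (@differentiableZl R 'M[R]_(M, N) R^o); exact: differentiable_coord.
Qed.

Variables (V : normedModType R) (G : V -> 'M[R]_(M, N)) (x : V).
Hypothesis dG : differentiable G x.

Lemma differentiable_mxform : differentiable (fun y => mxform (G y)) x.
Proof.
apply: (@differentiable_comp _ _ _ _ G mxform) => //.
exact/linear_differentiable/mxform_continuous.
Qed.

Lemma derive_mxform d : 'D_d (fun y => mxform (G y)) x = mxform ('D_d G x).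
Proof.
rewrite deriveE; last exact: differentiable_mxform.
rewrite (@diff_comp _ _ _ _ G mxform) //=; last first.
  exact/linear_differentiable/mxform_continuous.
by rewrite diff_lin ?deriveE //; exact: mxform_continuous.
Qed.

End MatrixForm.

End DotProduct.

Section ThirdDerivative.
Variables (R : realType) (N : nat) (f : 'cV[R]_N -> R).
Implicit Types (x u v w z d : 'cV[R]_N) (s : R).

Definition hform x u v : R := dotp u (hessian f x *m v).

Definition third x u v w : R := dotp v ('d (hessian f) x u *m w).

Lemma derive_partials (g : 'cV[R]_N -> R) x d : differentiable g x ->
  'D_d g x = dotp d (\col_i 'D_(delta_mx i 0) g x).
Proof.
move=> dg; rewrite deriveE // [d in LHS]matrix_sum_delta linear_sum /dotp mxE.
apply: eq_bigr => i _; rewrite big_ord1 linearZ /= !mxE deriveE //.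
Qed.

Hypothesis df : thrice_differentiable f.

Lemma is_derive_gradient x d : is_derive x d f (dotp d (gradient f x)).
Proof.
case: df => df1 _ _; split; first exact: diff_derivable.
exact: derive_partials.
Qed.

Lemma gradient_mxform z :
  (fun y => dotp z (gradient f y)) =
  (fun y => mxform z (1%:M : 'cV[R]_1) (gradient f y)).
Proof. by apply/funext => y; rewrite /mxform mulmx1. Qed.

Lemma differentiable_dotp_gradient x z :
  differentiable (fun y => dotp z (gradient f y)) x.
Proof.
by case: df => _ df2 _; rewrite gradient_mxform; exact: differentiable_mxform.
Qed.

Lemma is_derive_dotp_gradient x z d :
  is_derive x d (fun y => dotp z (gradient f y)) (hform x z d).
Proof.
split; first exact/diff_derivable/differentiable_dotp_gradient.
case: df => _ df2 _; rewrite gradient_mxform derive_mxform // /mxform mulmx1.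
rewrite /hform; congr dotp.
have gd : derivable (gradient f) x d by exact: diff_derivable.
rewrite derive_mx //; apply/matrixP => i j; rewrite ord1 !mxE.
rewrite derive_partials.
  by rewrite /dotp mxE; apply: eq_bigr => k _; rewrite !mxE mulrC.
apply: (@differentiable_comp _ _ _ _ (gradient f) (fun A : 'cV[R]_N => A i 0)) => //.
exact: differentiable_coord.
Qed.

Lemma differentiable_hform x u v : differentiable (fun y => hform y u v) x.
Proof. by case: df => _ _ df3; exact: differentiable_mxform. Qed.

Lemma is_derive_hform x u v d :
  is_derive x d (fun y => hform y u v) (third x d u v).
Proof.
split; first exact/diff_derivable/differentiable_hform.
by case: df => _ _ df3; rewrite derive_mxform // deriveE.
Qed.

Lemma hformC x u v : hform x u v = hform x v u.
Proof.
have := derive_comm (is_derive_gradient^~ u) (is_derive_gradient^~ v)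
  (differentiable_dotp_gradient x u) (differentiable_dotp_gradient x v).
have [_ ->] := is_derive_dotp_gradient x u v.
by have [_ ->] := is_derive_dotp_gradient x v u.
Qed.

Lemma hform_bilinear x : symmetric_bilinear (hform x).
Proof. by split=> [u v|a u v w]; [exact: hformC|exact: dotp_linearl]. Qed.

(** Differentiating the symmetry of the Hessian exchanges the last two arguments; Young's theorem
    for the derivative of [f] along [v] exchanges the outer two. These transpositions generate all
    permutations. *)
Lemma third_trilinear x : symmetric_trilinear (third x).
Proof.
have s23 u v w : third x u v w = third x u w v.
  have e : (fun y => hform y v w) = (fun y => hform y w v).
    by apply/funext => y; exact: hformC.
  have [_ <-] := is_derive_hform x v w u; rewrite e.
  by have [_ ->] := is_derive_hform x w v u.
have s13 u v w : third x u v w = third x w v u.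
  have := derive_comm (fun y => is_derive_dotp_gradient y v w)
    (fun y => is_derive_dotp_gradient y v u)
    (differentiable_hform x v w) (differentiable_hform x v u).
  have [_ ->] := is_derive_hform x v w u.
  by have [_ ->] := is_derive_hform x v u w.
split=> // [u v w|a u u' v w]; first by rewrite s23 s13 s23.
by rewrite /third linearD linearZ /= mulmxDl -scalemxAl dotp_linearr.
Qed.

Lemma is_derive_f_line x d s :
  is_derive s 1 (fun t : R => f (x + t *: d)) (dotp d (gradient f (x + s *: d))).
Proof. exact: is_derive_line (is_derive_gradient _ _). Qed.

Lemma is_derive_gradient_line x d z s :
  is_derive s 1 (fun t : R => dotp z (gradient f (x + t *: d)))
    (hform (x + s *: d) z d).
Proof. exact: is_derive_line (is_derive_dotp_gradient _ _ _). Qed.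

Lemma is_derive_hform_line x d u v s :
  is_derive s 1 (fun t : R => hform (x + t *: d) u v)
    (third (x + s *: d) d u v).
Proof. exact: is_derive_line (is_derive_hform _ _ _ _). Qed.

Lemma derive2_line x d s :
  derive1n 2 (fun t : R => f (x + t *: d)) s = hform (x + s *: d) d d.
Proof.
rewrite derive1nS derive1n1 derive1E.
have -> : derive1 (fun t : R => f (x + t *: d)) =
    (fun t => dotp d (gradient f (x + t *: d))).
  by apply/funext => t; rewrite derive1E; have [_ ->] := is_derive_f_line x d t.
by have [_ ->] := is_derive_gradient_line x d d s.
Qed.

Lemma derive3_line x d s :
  derive1n 3 (fun t : R => f (x + t *: d)) s = third (x + s *: d) d d d.
Proof.
rewrite derive1nS derive1E.
have -> : derive1n 2 (fun t : R => f (x + t *: d)) = (fun t => hform (x + t *: d) d d).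
  by apply/funext => t; exact: derive2_line.
by have [_ ->] := is_derive_hform_line x d d d s.
Qed.

End ThirdDerivative.

(** * Self-concordance along a line *)

Section RealDerivatives.
Variable R : realType.

Lemma is_derive_mul (f g : R -> R) (t a b : R) :
  is_derive t 1 f a -> is_derive t 1 g b ->
  is_derive t 1 (fun s => f s * g s) (f t * b + g t * a).
Proof. exact: is_deriveM. Qed.

Lemma is_derive_sub (f g : R -> R) (t a b : R) :
  is_derive t 1 f a -> is_derive t 1 g b ->
  is_derive t 1 (fun s => f s - g s) (a - b).
Proof. exact: is_deriveB. Qed.

Lemma is_derive_add (f g : R -> R) (t a b : R) :
  is_derive t 1 f a -> is_derive t 1 g b ->
  is_derive t 1 (fun s => f s + g s) (a + b).
Proof. exact: is_deriveD. Qed.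

Lemma is_derive_cubic (a b c e t : R) :
  is_derive t 1 (fun s => a + b * s + c * s ^+ 2 + e * s ^+ 3)
    (b + 2 * c * t + 3 * e * t ^+ 2).
Proof.
have d1 : is_derive t 1 (fun s : R => s) (1 : R) := is_derive_id t 1.
have dc (k : R) : is_derive t 1 (fun=> k) 0 := is_derive_cst k t 1.
have d2 : is_derive t 1 (fun s : R => s ^+ 2) (t * 1 + t * 1) := is_derive_mul d1 d1.
have d3 : is_derive t 1 (fun s : R => s ^+ 3) (t * (t * 1 + t * 1) + t ^+ 2 * 1) :=
  is_derive_mul d1 d2.
have := is_derive_add (is_derive_add (is_derive_add (dc a) (is_derive_mul (dc b) d1))
  (is_derive_mul (dc c) d2)) (is_derive_mul (dc e) d3).
by move=> h; apply: (is_derive_eq h); ring.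
Qed.

Lemma is_derive_inv_affine (r t : R) : 1 - t * r != 0 ->
  is_derive t 1 (fun s => (1 - s * r)^-1) (r * (1 - t * r) ^- 2).
Proof.
move=> tr; have h := is_derive_cubic 1 (- r) 0 0 t.
have e : (fun s => 1 + - r * s + 0 * s ^+ 2 + 0 * s ^+ 3) = (fun s => 1 - s * r).
  by apply/funext => s; ring.
rewrite e in h; apply: (is_derive_eq (@is_deriveV _ (fun s => 1 - s * r) t _ 1 tr h)).
rewrite /GRing.scale /=; ring.
Qed.

Lemma is_derive_inv_sqrt (f : R -> R) (t a : R) : 0 < f t ->
  is_derive t 1 f a ->
  is_derive t 1 (fun s => (Num.sqrt (f s))^-1) (- a / (2 * Num.sqrt (f t) ^+ 3)).
Proof.
move=> ft df; have st : Num.sqrt (f t) != 0 by rewrite sqrtr_eq0 -ltNge.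
have h := is_derive1_comp (is_derive1_sqrt ft) df.
apply: (is_derive_eq (@is_deriveV _ (fun s => Num.sqrt (f s)) t _ 1 st h)).
by rewrite /GRing.scale /=; field.
Qed.

End RealDerivatives.

(* [F t], [g t z], [Q t u v] and [T t u v w] stand for [f], [<z, grad f>] and the
   second and third derivatives of [f] at the point [x + t d]. *)
Section SelfConcordantLine.
Variables (R : realType) (V : lmodType R) (d : V).
Variables (F : R -> R) (g : R -> V -> R) (Q : R -> V -> V -> R).
Variable (T : R -> V -> V -> V -> R).
Implicit Types (u v w z : V) (s t a b : R).
Hypotheses (bQ : forall t, symmetric_bilinear (Q t))
  (pQ : forall t, positive_definite (Q t))
  (sT : forall t, symmetric_trilinear (T t))
  (T_diag : forall t u, `|T t u u u| <= 2 * form_norm (Q t) u ^+ 3)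
  (dF : forall t, is_derive t 1 F (g t d))
  (dg : forall z t, is_derive t 1 (g^~ z) (Q t z d))
  (dQ : forall u v t, is_derive t 1 (fun s => Q s u v) (T t d u v)).

Definition lnorm t u := form_norm (Q t) u.
Let r := lnorm 0 d.

Lemma lnormK t u : lnorm t u ^+ 2 = Q t u u.
Proof. exact: form_normK. Qed.

Lemma lnorm_ge0 t u : 0 <= lnorm t u. Proof. exact: form_norm_ge0. Qed.

Lemma lnorm_gt0 t u : u != 0 -> 0 < lnorm t u.
Proof. exact: form_norm_gt0. Qed.

Lemma lnorm0 t : lnorm t 0 = 0.
Proof. by rewrite /lnorm /form_norm bilinear0l // sqrtr0. Qed.

Lemma third_bound t u v : `|T t u v v| <= 2 * (lnorm t u * lnorm t v ^+ 2).
Proof. exact: trilinear_bound. Qed.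

(** The derivative of [(lnorm t d)^-1] is at least -1 by the diagonal bound, so [(lnorm t d)^-1 + t]
    is nondecreasing. *)
Lemma lnorm_line_le s : 0 <= s -> s * r < 1 -> lnorm s d <= r / (1 - s * r).
Proof.
move=> s0 sr; have [d0|d0] := eqVneq d 0.
  by rewrite /r d0 !lnorm0 mul0r.
have r0 : 0 < r by exact: lnorm_gt0.
have dI t : is_derive t 1 (fun t : R => (lnorm t d)^-1 + t)
    (- T t d d d / (2 * lnorm t d ^+ 3) + 1).
  refine (is_derive_add _ (is_derive_id t 1)).
  by apply: is_derive_inv_sqrt => //; exact: pQ.
have le_inv : r^-1 <= (lnorm s d)^-1 + s.
  suff : r^-1 + 0 <= (lnorm s d)^-1 + s by rewrite addr0.
  apply: (nondecreasing_of_derive s0 (fun t _ => dI t)) => t _.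
  have n0 : 0 < lnorm t d by exact: lnorm_gt0.
  have n3 : 0 < 2 * lnorm t d ^+ 3 by rewrite mulr_gt0 // exprn_gt0.
  rewrite addrC -lerBlDr sub0r mulNr opprK ler_pdivrMr // mul1r.
  exact: le_trans (ler_norm _) (T_diag _ _).
have n0 : 0 < lnorm s d by exact: lnorm_gt0.
have q1 : 0 < 1 - s * r by rewrite subr_gt0.
rewrite -lerBlDr in le_inv.
have e : r^-1 - s = (1 - s * r) / r by field; rewrite gt_eqF.
rewrite -[leLHS]invrK -[leRHS]invrK lef_pV2 ?posrE ?invr_gt0 ?divr_gt0 //.
by rewrite invf_div -e.
Qed.

Let q_gt0 s b : s <= b -> b * r < 1 -> 0 < 1 - s * r.
Proof.
move=> sb br; rewrite subr_gt0; apply: le_lt_trans br.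
by rewrite ler_wpM2r // lnorm_ge0.
Qed.

Lemma third_line_bound v s : 0 <= s -> s * r < 1 ->
  `|T s d v v| <= 2 * (r / (1 - s * r) * Q s v v).
Proof.
move=> s0 sr; apply: (le_trans (third_bound _ _ _)); rewrite lnormK.
by rewrite ler_wpM2l // ler_wpM2r ?form_ge0 // lnorm_line_le.
Qed.

(** By [third_line_bound], [Q t v v] decays at relative rate at most 2 r / (1 - t r), which is
    exactly the rate of (1 - t r)^2; hence the quotient is nondecreasing. *)
Lemma hform_line_lower v a b : 0 <= a -> a <= b -> b * r < 1 ->
  Q a v v * (1 - a * r)^-1 ^+ 2 <=
  Q b v v * (1 - b * r)^-1 ^+ 2.
Proof.
move=> a0 ab br.
pose psi t := Q t v v; pose u t := (1 - t * r)^-1.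
pose psi' t := T t d v v.
pose D t := psi t * (u t * (r * (1 - t * r) ^- 2) + u t * (r * (1 - t * r) ^- 2))
   + u t * u t * psi' t.
rewrite !expr2.
apply: (@nondecreasing_of_derive _ (fun t => psi t * (u t * u t)) D) => //
  t /andP[at_ tb].
  have q0 := q_gt0 tb br.
  have du : is_derive t 1 u (r * (1 - t * r) ^- 2).
    by apply: is_derive_inv_affine; rewrite gt_eqF.
  exact: (is_derive_mul (dQ v v t) (is_derive_mul du du)).
have q0 := q_gt0 tb br; have t0 := le_trans a0 at_.
have tr : t * r < 1 by rewrite -subr_gt0.
have u0 : 0 < u t by rewrite invr_gt0.
have := third_line_bound v t0 tr.
rewrite -/(psi' t) -/(psi t) -/(u t) ler_norml => /andP[h _].
have -> : D t = u t ^+ 2 * (psi' t + 2 * (r * u t * psi t)).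
  by rewrite /D /u; field; rewrite gt_eqF.
by rewrite mulr_ge0 ?sqr_ge0 // -lerBlDr sub0r.
Qed.

Lemma hform_line_upper v a b : 0 <= a -> a <= b -> b * r < 1 ->
  Q b v v * (1 - b * r) ^+ 2 <=
  Q a v v * (1 - a * r) ^+ 2.
Proof.
move=> a0 ab br.
pose psi t := Q t v v; pose u t := (1 - t * r).
pose psi' t := T t d v v.
have du t : is_derive t 1 u (- r).
  have h := is_derive_cubic 1 (- r) 0 0 t.
  have e : (fun s => 1 + - r * s + 0 * s ^+ 2 + 0 * s ^+ 3) = u.
    by apply/funext => s; rewrite /u; ring.
  by rewrite e in h; apply: (is_derive_eq h); ring.
pose D t := 0 - (psi t * (u t * - r + u t * - r) + u t * u t * psi' t).
rewrite -lerN2 -[leLHS]sub0r -[leRHS]sub0r !expr2.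
apply: (@nondecreasing_of_derive _ (fun t => 0 - psi t * (u t * u t)) D) => //
  t /andP[at_ tb].
  exact: (is_derive_sub (is_derive_cst 0 t 1)
    (is_derive_mul (dQ v v t) (is_derive_mul (du t) (du t)))).
have q0 := q_gt0 tb br; have t0 := le_trans a0 at_.
have tr : t * r < 1 by rewrite -subr_gt0.
have := third_line_bound v t0 tr.
rewrite -/(psi' t) -/(psi t) ler_norml => /andP[_ h].
have -> : D t = u t ^+ 2 * (2 * (r / (1 - t * r) * psi t) - psi' t).
  by rewrite /D /u; field; rewrite gt_eqF.
by rewrite mulr_ge0 ?sqr_ge0 // subr_ge0.
Qed.

Lemma lnorm_step_lower v : r < 1 -> (1 - r) * lnorm 0 v <= lnorm 1 v.
Proof.
move=> r1; have q0 : 0 < 1 - r by rewrite subr_gt0.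
have := @hform_line_lower v 0 1 (lexx _) ler01.
rewrite mul1r => /(_ r1); rewrite (mul0r r) (subr0 (1 : R)) invr1 expr1n mulr1.
rewrite -!lnormK -exprMn ler_pXn2r ?nnegrE ?mulr_ge0 ?lnorm_ge0 ?invr_ge0 ?(ltW q0) //.
by rewrite ler_pdivlMr // mulrC.
Qed.

Definition hform_diff s u v := Q s u v - Q 0 u v.

Lemma hform_diff_bilinear s : symmetric_bilinear (hform_diff s).
Proof.
split=> [u v|a u v w]; rewrite /hform_diff; first by rewrite 2!(proj1 (bQ _) u).
by rewrite !(proj2 (bQ _)); ring.
Qed.

Lemma hform_diff_bounds s : 0 <= s -> s * r < 1 -> forall v,
  ((1 - s * r) ^+ 2 - 1) * Q 0 v v <= hform_diff s v v <=
  ((1 - s * r) ^- 2 - 1) * Q 0 v v.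
Proof.
move=> s0 sr v; have q0 := q_gt0 (lexx s) sr.
have q2 : 0 < (1 - s * r) ^+ 2 by rewrite exprn_gt0.
have := hform_line_lower v (lexx 0) s0 sr; have := hform_line_upper v (lexx 0) s0 sr.
rewrite (mul0r r) (subr0 (1 : R)) invr1 expr1n !mulr1 exprVn => h1 h2.
rewrite -ler_pdivlMr // in h1; rewrite ler_pdivlMr // in h2.
by rewrite /hform_diff !mulrBl !mul1r !lerD2r ![_ * Q 0 v v]mulrC h1 h2.
Qed.

Let inv_sq s : 0 <= s -> s * r < 1 ->
  let c := (1 - s * r) ^- 2 in let e := (1 - s * r) ^+ 2 in
  [/\ 1 <= c, 0 < e, e <= 1 & c * e = 1].
Proof.
move=> s0 sr c e; have q0 := q_gt0 (lexx s) sr.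
have q1 : 1 - s * r <= 1 by rewrite gerBl mulr_ge0 // lnorm_ge0.
have c1 : 1 <= c by rewrite /c -exprVn exprn_ege1 // invf_ge1.
have e1 : e <= 1 by rewrite /e exprn_ile1 // ltW.
have ce : c * e = 1 by rewrite /c /e mulVf // expf_neq0 // gt_eqF.
by split=> //; rewrite exprn_gt0.
Qed.

(** The polarization bound is affine in [Q 0 z d], with slope half of c + e - 2, where e = (1 - s
    r)^2 and c = 1 / e. This slope is nonnegative, so the worst case is equality in
    Cauchy-Schwarz. *)
Lemma hform_diff_le s z : 0 <= s -> s * r < 1 ->
  hform_diff s z d <= ((1 - s * r) ^- 2 - 1) * (lnorm 0 z * r).
Proof.
move=> s0 sr; have [c1 e0 e1 ce] := inv_sq s0 sr.
have bE := hform_diff_bilinear s.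
have [->|z0] := eqVneq z 0; first by rewrite bilinear0l // lnorm0 mul0r mulr0.
have [d0|d0] := eqVneq d 0.
  by rewrite /r d0 (proj1 bE) bilinear0l // lnorm0 !mulr0.
have h := polarization_bound (bQ 0) (@pQ 0) bE (hform_diff_bounds s0 sr) z0 d0.
apply: le_trans h _.
have := cauchy_schwarz (bQ 0) (@pQ 0) z d; rewrite ler_norml => /andP[_].
rewrite -/(lnorm 0 z) -/(lnorm 0 d) -/r.
move: ((1 - s * r) ^+ 2) ((1 - s * r) ^- 2) c1 e0 e1 ce (lnorm 0 z * r) (Q 0 z d).
move=> e c c1 e0 e1 ce p q qp.
have h : 0 <= (c - 1) * (1 - e) by rewrite mulr_ge0 ?subr_ge0.
have ce2 : 0 <= c + e - 2 by nra.
have : 0 <= (c + e - 2) * (p - q) by rewrite mulr_ge0 // subr_ge0.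
nra.
Qed.

(** Antiderivative of the slack in [hform_diff_le], hence nondecreasing; its increment over the unit
    interval is the slack in [gradient_line_le]. *)
Let defect z s := lnorm 0 z * ((1 - s * r)^-1 - s * r) - (g s z - s * Q 0 z d).

Let defect' z s := lnorm 0 z * r * ((1 - s * r) ^- 2 - 1) - hform_diff s z d.

Let is_derive_scale (k t : R) : is_derive t 1 (fun s => s * k) k.
Proof.
apply: (is_derive_eq (is_derive_mul (is_derive_id t 1) (is_derive_cst k t 1))).
by rewrite mulr0 add0r mulr1.
Qed.

Let is_derive_defect z s : 1 - s * r != 0 -> is_derive s 1 (defect z) (defect' z s).
Proof.
move=> sr.
have h := is_derive_sub
  (is_derive_mul (is_derive_cst (lnorm 0 z) s 1)
    (is_derive_sub (is_derive_inv_affine sr) (is_derive_scale r s)))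
  (is_derive_sub (dg z s) (is_derive_scale (Q 0 z d) s)).
by apply: (is_derive_eq h); rewrite /defect' /hform_diff /cst; ring.
Qed.

Let defect'_ge0 z s : 0 <= s -> s * r < 1 -> 0 <= defect' z s.
Proof.
by move=> s0 sr; rewrite /defect' subr_ge0 [leRHS]mulrC hform_diff_le.
Qed.

Let in_unit s : r < 1 -> 0 <= s <= 1 -> s * r < 1.
Proof.
by move=> r1 /andP[_ s1]; apply: le_lt_trans r1; rewrite ler_piMl // lnorm_ge0.
Qed.

Let defect_incr z : r < 1 -> defect z 1 - defect z 0 =
  r ^+ 2 / (1 - r) * lnorm 0 z - (g 1 z - g 0 z - Q 0 z d).
Proof.
move=> r1; rewrite /defect; field.
by rewrite !gt_eqF ?subr_gt0 ?mul0r ?subr0 ?ltr01.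
Qed.

Lemma gradient_line_le z : r < 1 ->
  g 1 z - g 0 z - Q 0 z d <= r ^+ 2 / (1 - r) * lnorm 0 z.
Proof.
move=> r1; rewrite -subr_ge0 -defect_incr // subr_ge0.
apply: (@nondecreasing_of_derive _ (defect z) (defect' z) 0 1 ler01) => s s01.
  by apply: is_derive_defect; rewrite gt_eqF // subr_gt0 in_unit.
by apply: defect'_ge0; [case/andP: s01|exact: in_unit].
Qed.

(** Chaining [gradient_line_le] with [lnorm_step_lower] gives the weak inequality. If it were an
    equality, both would be sharp: the first makes [z] parallel to [d] with the form growing along
    it, the second makes the form shrink along [z]. *)
Lemma gradient_line_lt z : r < 1 -> z != 0 -> d != 0 ->
  g 1 z - g 0 z - Q 0 z d < r ^+ 2 / (1 - r) ^+ 2 * lnorm 1 z.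
Proof.
move=> r1 z0 d0; rewrite ltNge; apply/negP => hge.
have q0 : 0 < 1 - r by rewrite subr_gt0.
have r0 : 0 < r by exact: lnorm_gt0.
have n0 : 0 < lnorm 0 z by exact: lnorm_gt0.
have hz := lnorm_step_lower z r1.
have hle := gradient_line_le z r1.
have k0 : 0 < r ^+ 2 / (1 - r) by rewrite divr_gt0 // exprn_gt0.
have eK : r ^+ 2 / (1 - r) ^+ 2 = r ^+ 2 / (1 - r) * (1 - r)^-1.
  by field; rewrite gt_eqF.
have hz1 : lnorm 0 z <= (1 - r)^-1 * lnorm 1 z by rewrite ler_pdivlMl.
have hz2 : (1 - r)^-1 * lnorm 1 z <= lnorm 0 z.
  by rewrite -(ler_pM2l k0) mulrA -eK; exact: le_trans hle.
have hfl : r ^+ 2 / (1 - r) * lnorm 0 z <= g 1 z - g 0 z - Q 0 z d.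
  by apply: le_trans hge; rewrite eK -(mulrA (r ^+ 2 / (1 - r))) (ler_pM2l k0).
have half : 0 < (1 / 2 : R) < 1 by lra.
have half' : 0 <= (1 / 2 : R) <= 1 by lra.
have hr : 1 / 2 * r < 1 by exact: in_unit.
(* A monotone defect without increment has zero derivative inside; the midpoint serves as the test
   point. *)
have hD : defect' z (1 / 2) = 0.
  apply: (@derive_eq0_of_nondecreasing _ (defect z) (defect' z) 0 1 (1 / 2) half)
    => [s s01|s s01|].
  - by apply: is_derive_defect; rewrite gt_eqF // subr_gt0 in_unit.
  - by apply: defect'_ge0; [case/andP: s01|exact: in_unit].
  - by rewrite -subr_le0 defect_incr // subr_le0.
set s := 1 / 2 in half half' hr hD; have s0 : 0 <= s by case/andP: half'.
have [c1 e0 e1 ce] := inv_sq s0 hr.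
have hE : hform_diff s z d = ((1 - s * r) ^- 2 - 1) * (lnorm 0 z * r).
  by apply/eqP; rewrite -subr_eq0 -oppr_eq0 opprB [_ * (lnorm 0 z * r)]mulrC; apply/eqP.
(* Maximal shrinkage along [z] over the whole step forces maximal shrinkage up to time [s]. *)
have hZ : hform_diff s z z <= ((1 - s * r) ^+ 2 - 1) * Q 0 z z.
  have := hform_line_lower z s0 (proj2 (andP half')).
  rewrite mul1r => /(_ r1) h.
  rewrite /hform_diff mulrBl mul1r lerD2r mulrC -ler_pdivrMr // -exprVn.
  apply: (le_trans h); rewrite -!lnormK -exprMn.
  rewrite ler_pXn2r ?nnegrE ?mulr_ge0 ?lnorm_ge0 ?invr_ge0 ?(ltW q0) //.
  by rewrite mulrC.
have bE := hform_diff_bilinear s.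
have := polarization_bound (bQ 0) (@pQ 0) bE (hform_diff_bounds s0 hr) z0 d0.
rewrite hE -/(lnorm 0 z) -/(lnorm 0 d) -/r => hp.
have sr0 : 0 < s * r by rewrite mulr_gt0 //; case/andP: half.
have e2 : (1 - s * r) ^+ 2 < 1 by rewrite exprn_ilt1 // ?gtrBl // subr_ge0 ltW.
(* Since s r > 0, the slope c + e - 2 is now strictly positive, so attaining the bound forces
   equality in Cauchy-Schwarz. *)
have hq : lnorm 0 z * r <= Q 0 z d.
  move: ((1 - s * r) ^+ 2) ((1 - s * r) ^- 2) (lnorm 0 z * r) (Q 0 z d)
    c1 e2 e0 e1 ce hp.
  move=> e c p q c1 e2 e0 e1 ce hp; rewrite leNgt; apply/negP => qp.
  have ce2 : 0 < c + e - 2.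
    have c2 : 1 < c by rewrite -ce gtr_pMr //; lra.
    have : 0 < (c - 1) * (1 - e) by rewrite mulr_gt0 ?subr_gt0.
    by nra.
  have : 0 < (c + e - 2) * (p - q) by rewrite mulr_gt0 // subr_gt0.
  by nra.
have wle : Q 0 (r *: z + (- lnorm 0 z) *: d) (r *: z + (- lnorm 0 z) *: d) <= 0.
  rewrite bilinear_expand // -!lnormK -/r.
  move: (lnorm 0 z) (Q 0 z d) n0 hq => n q n0 hq.
  have : 0 <= (n * r) * (q - n * r) by rewrite mulr_ge0 ?subr_ge0 // mulr_ge0 // ltW.
  by nra.
have w0 : r *: z + (- lnorm 0 z) *: d = 0.
  by apply: contraTeq wle => /(@pQ 0); rewrite ltNge.
have rz : r *: z = lnorm 0 z *: d.
  by apply/eqP; rewrite -subr_eq0 -scaleNr w0.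
(* As [z] is a positive multiple of [d], the growth in [hE] transfers to [hform_diff s z z], against
   [hZ]. *)
have hEr : r * hform_diff s z z = lnorm 0 z * hform_diff s z d.
  by rewrite -bilinearZl // rz bilinearZl // (proj1 bE).
have : lnorm 0 z * hform_diff s z d <= r * (((1 - s * r) ^+ 2 - 1) * Q 0 z z).
  by rewrite -hEr ler_pM2l.
rewrite hE -lnormK.
have -> : lnorm 0 z * (((1 - s * r) ^- 2 - 1) * (lnorm 0 z * r)) =
  r * lnorm 0 z ^+ 2 * ((1 - s * r) ^- 2 - 1) by ring.
have -> : r * (((1 - s * r) ^+ 2 - 1) * lnorm 0 z ^+ 2) =
  r * lnorm 0 z ^+ 2 * ((1 - s * r) ^+ 2 - 1) by ring.
rewrite ler_pM2l ?mulr_gt0 ?exprn_gt0 // lerD2r.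
by apply/negP; rewrite -ltNge; exact: lt_le_trans c1.
Qed.

Lemma f_line_upper s : 0 <= s -> s * r <= 1 / 2 ->
  F s <= F 0 + g 0 d * s + r ^+ 2 / 2 * s ^+ 2 + r ^+ 3 * s ^+ 3.
Proof.
move=> s0 sr; have r0 : 0 <= r by exact: lnorm_ge0.
have tr t : t <= s -> t * r <= 1 / 2.
  by move=> ts; apply: le_trans sr; rewrite ler_wpM2r.
(* 6 is the slope of the chord of (1 - y)^-2 over [0, 1/2], which lies above that convex function.
   Two integrations turn 6 into 3 and then into the coefficient 1 of the cubic term. *)
have hQ t : 0 <= t -> t <= s -> Q t d d <= r ^+ 2 + 6 * r ^+ 3 * t.
  move=> t0 ts; have t1 : t * r < 1 by have := tr t ts; lra.
  have := hform_line_upper d (lexx 0) t0 t1.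
  rewrite (mul0r r) (subr0 (1 : R)) expr1n mulr1 -(lnormK 0 d) -/r => h.
  have q2 : 0 < (1 - t * r) ^+ 2 by rewrite exprn_gt0 // subr_gt0.
  rewrite -(ler_pM2r q2); apply: (le_trans h).
  have -> : (r ^+ 2 + 6 * r ^+ 3 * t) * (1 - t * r) ^+ 2 =
    r ^+ 2 + r ^+ 2 * (t * r * (4 - 11 * (t * r) + 6 * (t * r) ^+ 2)) by ring.
  rewrite lerDl mulr_ge0 ?sqr_ge0 //.
  have y0 : 0 <= t * r by rewrite mulr_ge0.
  rewrite mulr_ge0 //; move: (t * r) (tr t ts) y0 => y y1 y0; nra.
have hG t : 0 <= t -> t <= s -> g t d <= g 0 d + r ^+ 2 * t + 3 * r ^+ 3 * t ^+ 2.
  move=> t0 ts.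
  pose G y := (g 0 d + r ^+ 2 * y + 3 * r ^+ 3 * y ^+ 2 + 0 * y ^+ 3) - g y d.
  have : G 0 <= G t.
    pose G' y := (r ^+ 2 + 2 * (3 * r ^+ 3) * y + 3 * 0 * y ^+ 2) - Q y d d.
    apply: (@nondecreasing_of_derive _ G G' _ _ t0) => y /andP[y0 yt].
      exact: (is_derive_sub (is_derive_cubic _ _ _ _ y) (dg d y)).
    by rewrite subr_ge0; apply: (le_trans (hQ y y0 (le_trans yt ts))); lra.
  by rewrite /G !expr0n !mulr0 !mul0r !addr0 subrr subr_ge0.
pose H y := (F 0 + g 0 d * y + r ^+ 2 / 2 * y ^+ 2 + r ^+ 3 * y ^+ 3) - F y.
have : H 0 <= H s.
  pose H' y := (g 0 d + 2 * (r ^+ 2 / 2) * y + 3 * r ^+ 3 * y ^+ 2) - g y d.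
  apply: (@nondecreasing_of_derive _ H H' _ _ s0) => y /andP[y0 ys].
    exact: (is_derive_sub (is_derive_cubic _ _ _ _ y) (dF y)).
  by rewrite subr_ge0; apply: (le_trans (hG y y0 ys)); lra.
by rewrite /H !expr0n !mulr0 !addr0 subrr subr_ge0.
Qed.

End SelfConcordantLine.

(** * Decrements and steps *)

Section SelfConcordance.
Variables (R : realType) (N : nat) (f : 'cV[R]_N -> R).
Hypotheses (fpd : hessian_posdef f) (fsc : self_concordant f).
Implicit Types (x u v w z d : 'cV[R]_N) (s t : R).

Let df : thrice_differentiable f. Proof. by case: fsc. Qed.
Let bQ x := hform_bilinear df x.
Let pQ x : positive_definite (hform f x). Proof. by move=> u; exact: fpd. Qed.

Definition local_norm x u := form_norm (hform f x) u.

Lemma local_norm_ge0 x u : 0 <= local_norm x u.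
Proof. exact: form_norm_ge0. Qed.

Lemma local_norm_gt0 x u : u != 0 -> 0 < local_norm x u.
Proof. exact: form_norm_gt0. Qed.

Lemma local_normK x u : local_norm x u ^+ 2 = hform f x u u.
Proof. exact: form_normK. Qed.

Lemma local_normN x u : local_norm x (- u) = local_norm x u.
Proof. by rewrite -scaleN1r /local_norm form_normZ // normrN normr1 mul1r. Qed.

Lemma local_norm0 x : local_norm x 0 = 0.
Proof. by rewrite /local_norm /form_norm bilinear0l // sqrtr0. Qed.

Lemma powR_three_halves (a : R) : 0 <= a -> a `^ (3 / 2) = Num.sqrt a ^+ 3.
Proof.
move=> a0; rewrite -(powR12_sqrt a0) -powR_mulrn ?powR_ge0 // -powRrM.
by congr (_ `^ _); ring.
Qed.

Lemma third_diag_bound x u : `|third f x u u u| <= 2 * local_norm x u ^+ 3.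
Proof.
have [_ _ h] := fsc; have {h} : `|derive1n 3 (fun t => f (x + t *: u)) 0| <=
  2 * (derive1n 2 (fun t => f (x + t *: u)) 0) `^ (3 / 2) := h x u 0.
by rewrite derive3_line // derive2_line // scale0r addr0 powR_three_halves // form_ge0.
Qed.

Section Line.
(* The line is kept abstract: comparing points [x + s *: d] and [x + t *: d] by
   conversion is prohibitively slow. *)
Variables (x d : 'cV[R]_N) (l : R -> 'cV[R]_N).
Hypothesis lE : forall t, l t = x + t *: d.

Let l0 : l 0 = x. Proof. by rewrite lE scale0r addr0. Qed.

Let l1 : l 1 = x + d. Proof. by rewrite lE scale1r. Qed.

Let lfun : l = (fun t => x + t *: d). Proof. exact/funext. Qed.

Let F t := f (l t).
Let g t z := dotp z (gradient f (l t)).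
Let Q t := hform f (l t).
Let T t := third f (l t).

Let dF t : is_derive t 1 F (g t d).
Proof. by rewrite /F /g lfun; exact: is_derive_f_line. Qed.

Let dg z t : is_derive t 1 (g^~ z) (Q t z d).
Proof. by rewrite /Q /g lfun; exact: is_derive_gradient_line. Qed.

Let dQ u v t : is_derive t 1 (fun s => Q s u v) (T t d u v).
Proof. by rewrite /Q /T lfun; exact: is_derive_hform_line. Qed.

Let bQl t : symmetric_bilinear (Q t). Proof. exact: bQ. Qed.
Let pQl t : positive_definite (Q t). Proof. exact: pQ. Qed.
Let sT t : symmetric_trilinear (T t). Proof. exact: third_trilinear. Qed.
Let T_diag t u : `|T t u u u| <= 2 * form_norm (Q t) u ^+ 3.
Proof. exact: third_diag_bound. Qed.

Lemma local_norm_line_lower v : local_norm x d < 1 ->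
  (1 - local_norm x d) * local_norm x v <= local_norm (x + d) v.
Proof.
have := @lnorm_step_lower R _ d Q T bQl pQl sT T_diag dQ v.
by rewrite /lnorm /Q l0 l1.
Qed.

Lemma gradient_line_upper z : local_norm x d < 1 ->
  dotp z (gradient f (x + d)) - dotp z (gradient f x) - hform f x z d
  <= local_norm x d ^+ 2 / (1 - local_norm x d) * local_norm x z.
Proof.
have := @gradient_line_le R _ d g Q T bQl pQl sT T_diag dg dQ z.
by rewrite /lnorm /Q /g l0 l1.
Qed.

Lemma gradient_line_strict_upper z : local_norm x d < 1 -> z != 0 -> d != 0 ->
  dotp z (gradient f (x + d)) - dotp z (gradient f x) - hform f x z d
  < local_norm x d ^+ 2 / (1 - local_norm x d) ^+ 2 * local_norm (x + d) z.
Proof.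
have := @gradient_line_lt R _ d g Q T bQl pQl sT T_diag dg dQ z.
by rewrite /lnorm /Q /g l0 l1.
Qed.

Lemma value_line_upper s : 0 <= s -> s * local_norm x d <= 1 / 2 ->
  f (l s) <= f x + dotp d (gradient f x) * s
    + local_norm x d ^+ 2 / 2 * s ^+ 2 + local_norm x d ^+ 3 * s ^+ 3.
Proof.
have := @f_line_upper R _ d F g Q T bQl pQl sT T_diag dF dg dQ s.
by rewrite /lnorm /Q /g /F l0.
Qed.

End Line.

Lemma local_norm_step x d v : local_norm x d < 1 ->
  (1 - local_norm x d) * local_norm x v <= local_norm (x + d) v.
Proof. exact: (@local_norm_line_lower _ _ (fun t => x + t *: d)). Qed.

Lemma gradient_step x d z : local_norm x d < 1 ->
  dotp z (gradient f (x + d)) - dotp z (gradient f x) - hform f x z d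
  <= local_norm x d ^+ 2 / (1 - local_norm x d) * local_norm x z.
Proof. exact: (@gradient_line_upper _ _ (fun t => x + t *: d)). Qed.

Lemma gradient_step_strict x d z : local_norm x d < 1 -> z != 0 -> d != 0 ->
  dotp z (gradient f (x + d)) - dotp z (gradient f x) - hform f x z d
  < local_norm x d ^+ 2 / (1 - local_norm x d) ^+ 2 * local_norm (x + d) z.
Proof. exact: (@gradient_line_strict_upper _ _ (fun t => x + t *: d)). Qed.

Lemma value_step x d s : 0 <= s -> s * local_norm x d <= 1 / 2 ->
  f (x + s *: d) <= f x + dotp d (gradient f x) * s
    + local_norm x d ^+ 2 / 2 * s ^+ 2 + local_norm x d ^+ 3 * s ^+ 3.
Proof. exact: (@value_line_upper _ _ (fun t => x + t *: d)). Qed.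

(** The hypothesis on [d] cancels the linearised gradient against [z], so [gradient_step_strict]
    bounds [m ^+ 2]; dividing by [m] finishes. *)
Lemma dual_step_strict x d y z r m : y = x + d -> local_norm x d = r ->
    0 < r < 1 -> hform f x z d = - dotp z (gradient f x) ->
    local_norm y z = m -> dotp z (gradient f y) = m ^+ 2 ->
  m < (r / (1 - r)) ^+ 2.
Proof.
move=> -> dr /andP[r0 r1] zd zm zg; have q0 : 0 < 1 - r by rewrite subr_gt0.
have [z0|z0] := eqVneq z 0.
  by rewrite -zm z0 local_norm0 exprn_gt0 // divr_gt0.
have d0 : d != 0.
  by apply: contraTneq r0 => d0; rewrite -dr d0 local_norm0 ltxx.
have m0 : 0 < m by rewrite -zm local_norm_gt0.
have := @gradient_step_strict x d z; rewrite dr zd zm zg => /(_ r1 z0 d0).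
by rewrite opprK subrK [ltLHS]expr2 ltr_pM2r // expr_div_n.
Qed.

(** Here [e], not the step [d], cancels the gradient against [z]; the remainder
    [hform f x z (d - e)] is handled by Cauchy-Schwarz. It is applied with [d] coarse and [e]
    Newton. *)
Lemma dual_step x d e y z r m : y = x + d -> local_norm x d = r ->
    0 < r < 1 -> hform f x z e = - dotp z (gradient f x) ->
    local_norm y z = m -> dotp z (gradient f y) = m ^+ 2 ->
  m <= (r ^+ 2 / (1 - r) + local_norm x (d - e)) / (1 - r).
Proof.
have key (a D h k q E : R) : a - D - h <= k * q -> D + h <= q * E -> a <= (k + E) * q.
  by lra.
move=> -> dr /andP[r0 r1] ze zm zg; have q0 : 0 < 1 - r by rewrite subr_gt0.
have k0 : 0 <= r ^+ 2 / (1 - r) + local_norm x (d - e).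
  by rewrite addr_ge0 ?local_norm_ge0 // divr_ge0 ?sqr_ge0 // ltW.
have : 0 <= m by rewrite -zm local_norm_ge0.
rewrite le_eqVlt => /predU1P[<-|m0]; first by rewrite divr_ge0 // ltW.
have := @gradient_step x d z; have := @local_norm_step x d z; rewrite dr zm zg.
move=> /(_ r1); rewrite mulrC -ler_pdivlMr // => hz /(_ r1) hg.
have hc : dotp z (gradient f x) + hform f x z d <=
    local_norm x z * local_norm x (d - e).
  apply: le_trans (cauchy_schwarz (bQ x) (@pQ x) _ _); apply: le_trans (ler_norm _).
  have -> : hform f x z (d - e) = hform f x z d - hform f x z e.
    by rewrite /hform mulmxBr dotpDr dotpNr.
  by rewrite ze opprK addrC.
rewrite -(ler_pM2r m0) -expr2 mulrAC -mulrA.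
exact: le_trans (key _ _ _ _ _ _ hg hc) (ler_wpM2l k0 hz).
Qed.

Lemma posdef_unitmx n (A : 'M[R]_n) :
  (forall u : 'cV[R]_n, u != 0 -> 0 < dotp u (A *m u)) -> A \in unitmx.
Proof.
move=> pA; rewrite -row_free_unit -kermx_eq0; apply/eqP/eqP/rowV0P => v.
move=> /sub_kermxP vA; apply/eqP; apply: contraT => v0.
have := pA v^T; rewrite trmx_eq0 => /(_ v0).
by rewrite /dotp trmxK mulmxA vA mul0mx mxE ltxx.
Qed.

Lemma hform_newton x z : hform f x z (newton_direction f x) = - dotp z (gradient f x).
Proof.
rewrite /hform /newton_direction mulmxN dotpNr mulmxA mulmxV ?mul1mx //.
by apply: posdef_unitmx => u; exact: fpd.
Qed.

Lemma newton_decrementE x : newton_decrement f x = local_norm x (newton_direction f x).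
Proof.
rewrite /newton_decrement /local_norm /form_norm hform_newton.
by rewrite [in RHS]/newton_direction [dotp (- _) _]dotpC dotpNr opprK.
Qed.

(** * The coarse step and its effect on both decrements *)

Section Coarse.
Variables (n : nat) (P : 'M[R]_(N, n)).
Hypothesis rkP : \rank P = n.

Lemma reduced_hessian_unit x : reduced_hessian P f x \in unitmx.
Proof.
apply: posdef_unitmx => u u0.
rewrite /reduced_hessian -!mulmxA -(trmxK P) -dotp_mulmxl trmxK; apply: fpd.
apply: contraNneq u0 => Pu.
have fP : row_free P^T by rewrite /row_free mxrank_tr rkP.
rewrite -trmx_eq0 -(mulmx_free_eq0 _ fP) -trmx_mul Pu trmx0 //.
Qed.

Lemma hform_coarse x (w : 'cV[R]_n) :
  hform f x (P *m w) (coarse_direction P f x) = - dotp (P *m w) (gradient f x).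
Proof.
rewrite /hform /coarse_direction mulmxN dotpNr !dotp_mulmxl; congr (- dotp _ _).
have e (u : 'cV[R]_n) : P^T *m (hessian f x *m (P *m u)) = reduced_hessian P f x *m u.
  by rewrite /reduced_hessian !mulmxA.
by rewrite e mulKVmx // reduced_hessian_unit.
Qed.

Lemma coarse_direction_image x : exists w : 'cV[R]_n, coarse_direction P f x = P *m w.
Proof.
exists (- (invmx (reduced_hessian P f x) *m reduced_gradient P f x)).
by rewrite mulmxN.
Qed.

Lemma approximate_decrementE x :
  approximate_decrement P f x = local_norm x (coarse_direction P f x).
Proof.
rewrite /approximate_decrement /local_norm /form_norm; congr Num.sqrt.
have [w dw] := coarse_direction_image x; rewrite {1}dw hform_coarse -dw.
rewrite /coarse_direction [dotp (- _) _]dotpC dotpNr opprK [RHS]dotpC.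
by rewrite dotp_mulmxl dotpC.
Qed.

Lemma dotp_coarse x :
  dotp (coarse_direction P f x) (gradient f x) = - approximate_decrement P f x ^+ 2.
Proof.
rewrite approximate_decrementE local_normK.
by have [w dw] := coarse_direction_image x; rewrite {2}dw hform_coarse opprK -dw.
Qed.

(** Pythagoras: by [hform_coarse] and [hform_newton], the coarse direction is the Hessian-orthogonal
    projection of the Newton direction onto the range of [P]. *)
Lemma local_norm_coarse_sub_newton x :
  local_norm x (coarse_direction P f x - newton_direction f x) ^+ 2 =
  newton_decrement f x ^+ 2 - approximate_decrement P f x ^+ 2.
Proof.
have := bilinear_expand 1 (- 1) (coarse_direction P f x) (newton_direction f x) (bQ x).
rewrite scale1r scaleN1r -!local_normK -approximate_decrementE -newton_decrementE => ->.
by rewrite hform_newton dotp_coarse; ring.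
Qed.

Lemma approximate_decrement_le x : approximate_decrement P f x <= newton_decrement f x.
Proof.
rewrite -(@ler_pXn2r _ 2) ?nnegrE ?sqrtr_ge0 //.
by rewrite -subr_ge0 -local_norm_coarse_sub_newton sqr_ge0.
Qed.

Lemma approximate_decrement_step x (r := approximate_decrement P f x) :
  0 < r < 1 ->
  approximate_decrement P f (x + coarse_direction P f x) < (r / (1 - r)) ^+ 2.
Proof.
move=> r01; set y := x + _.
have [w dw] := coarse_direction_image y.
(* The test vector is minus the coarse direction at [y]: it lies in the range of [P], and its
   pairing with the gradient is its squared local norm. *)
apply: (@dual_step_strict x (coarse_direction P f x) y (P *m (- w))) => //.
- by rewrite /r approximate_decrementE.
- exact: hform_coarse.
- by rewrite mulmxN -dw local_normN approximate_decrementE.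
- by rewrite mulmxN -dw dotpC dotpNr dotpC dotp_coarse opprK.
Qed.

Lemma newton_decrement_step x (mu : R) (r := approximate_decrement P f x) :
  0 < mu < 1 -> 0 < r < 1 -> mu * newton_decrement f x < r ->
  newton_decrement f (x + coarse_direction P f x) <
  (Num.sqrt (1 - mu ^+ 2) + r) / (1 - r) ^+ 2 * newton_decrement f x.
Proof.
move=> /andP[mu0 mu1] r01 mur; have /andP[r0 r1] := r01; set y := x + _.
have h : newton_decrement f y <= (r ^+ 2 / (1 - r) +
    local_norm x (coarse_direction P f x - newton_direction f x)) / (1 - r).
  apply: (@dual_step x (coarse_direction P f x) (newton_direction f x) y
    (- newton_direction f y)) => //.
  - by rewrite /r approximate_decrementE.
  - exact: hform_newton.
  - by rewrite local_normN newton_decrementE.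
  - rewrite newton_decrementE local_normK -[LHS]opprK -hform_newton.
    by rewrite hformC // /hform mulmxN dotpNr opprK.
apply: (le_lt_trans h) => {h}.
have := local_norm_coarse_sub_newton x; rewrite -/r.
have := local_norm_ge0 x (coarse_direction P f x - newton_direction f x).
move: (local_norm x _) => E E0 EK.
have := approximate_decrement_le x; rewrite -/r.
move: (newton_decrement f x) mur EK => lam mur EK rlam.
move: r r01 r0 r1 mur EK rlam => {y} r r01 r0 r1 mur EK rlam.
have q0 : 0 < 1 - r by rewrite subr_gt0.
have e2 : 0 < 1 - mu ^+ 2 by rewrite subr_gt0 exprn_ilt1 // ltW.
set eps := Num.sqrt _; have eps0 : 0 < eps by rewrite sqrtr_gt0.
have epsK : eps ^+ 2 = 1 - mu ^+ 2 by rewrite sqr_sqrtr // ltW.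
have lam0 : 0 < lam by exact: lt_le_trans rlam.
have el : 0 < eps * lam by rewrite mulr_gt0.
have hE : E < eps * lam.
  rewrite -(@ltr_pXn2r _ 2) ?nnegrE ?(ltW el) // EK exprMn epsK.
  have : (mu * lam) ^+ 2 < r ^+ 2.
    by rewrite ltr_pXn2r ?nnegrE ?(ltW r0) // mulr_ge0 // ltW.
  by rewrite exprMn; lra.
have -> : (eps + r) / (1 - r) ^+ 2 * lam = (eps + r) * lam / (1 - r) / (1 - r).
  by field; rewrite gt_eqF.
rewrite ltr_pM2r ?invr_gt0 // ltr_pdivlMr // mulrDl divfK ?gt_eqF //.
(* It remains to use [r <= lam] in r^2 and to drop the negative term - eps lam r. *)
apply: (@lt_le_trans _ _ (r ^+ 2 + eps * lam * (1 - r))).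
  by rewrite ltrD2l ltr_pM2r.
have h1 : r ^+ 2 <= r * lam by rewrite expr2 ler_pM2l.
have h2 : 0 <= eps * lam * r by rewrite mulr_ge0 // ltW.
lra.
Qed.

(** The last hypothesis is the sufficient decrease of the cubic upper model from [value_step],
    divided by t r^2. *)
Lemma sufficient_decrease_coarse (alpha : R) x t (r := approximate_decrement P f x) :
    0 <= t -> t * r <= 1 / 2 -> t / 2 + t ^+ 2 * r <= 1 - alpha ->
  sufficient_decrease f alpha x (coarse_direction P f x) t.
Proof.
have key (y b : R) : 0 <= t * b ^+ 2 * (1 - alpha - (t / 2 + t ^+ 2 * b)) ->
    y + - b ^+ 2 * t + b ^+ 2 / 2 * t ^+ 2 + b ^+ 3 * t ^+ 3 <=
    y + alpha * t * - b ^+ 2.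
  by lra.
move=> t0 tr ht; rewrite /sufficient_decrease.
rewrite [dotp (gradient _ _) _]dotpC dotp_coarse -/r.
have := @value_step x (coarse_direction P f x) t t0.
rewrite -approximate_decrementE -/r dotp_coarse -/r => /(_ tr) h; apply: le_trans h _.
by apply: key; rewrite mulr_ge0 ?subr_ge0 // mulr_ge0 // sqr_ge0.
Qed.

End Coarse.

End SelfConcordance.

(** * Backtracking and the choice of the constants *)

Lemma backtracking_step_lower (R : realType) (N : nat) (f : 'cV[R]_N -> R)
    (alpha beta b : R) (x d : 'cV[R]_N) (t : R) :
    0 < beta -> b <= 1 ->
    (forall s, 0 <= s <= b -> sufficient_decrease f alpha x d s) ->
    backtracking_step f alpha beta x d t -> beta < 1 ->
  beta * b <= t.
Proof.
move=> beta0 b1 hb [[|m] [-> _ hm]] beta1.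
  rewrite expr0; apply: le_trans (_ : beta <= 1); last exact: ltW.
  by rewrite ler_piMr // ltW.
(* The preceding trial [beta ^+ m] was rejected, so it exceeds [b]. *)
rewrite exprS ler_pM2l // leNgt; apply/negP => bm.
have := hm m (ltnSn m); rewrite hb //.
by rewrite (ltW bm) exprn_ge0 // ltW.
Qed.

Lemma backtracking_step_unit (R : realType) (N : nat) (f : 'cV[R]_N -> R)
    (alpha beta : R) (x d : 'cV[R]_N) (t : R) :
    sufficient_decrease f alpha x d 1 ->
    backtracking_step f alpha beta x d t -> t = 1.
Proof. by move=> h1 [[|m] [-> _ hm]] //; have := hm 0%N isT; rewrite expr0 h1. Qed.

(* gamma and eta depend only on mu, alpha and beta: they are uniform in the
   problem, in nu and the tolerance, and in the iterates. *)
Theorem lemma3p9 (R : realType) (mu alpha beta : R)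
    (hmu : 0 < mu < 1) (halpha : 0 < alpha < 1 / 2) (hbeta : 0 < beta < 1) :
  exists gamma eta : R,
    [/\ 0 < gamma, 0 < eta < (3 - Num.sqrt 5) / 2 &
    forall (N n : nat) (P : 'M[R]_(N, n)) (f : 'cV[R]_N -> R) (nu tol : R)
        (x0 : 'cV[R]_N) (K : nat) (x : nat -> 'cV[R]_N) (t : nat -> R),
      (n <= N)%N ->
      \rank P = n ->
      0 < nu < (68 / 100) ^+ 2 ->
      nu < tol < (68 / 100) ^+ 2 ->
      hessian_posdef f ->
      self_concordant f ->
      bounded_below f ->
      has_minimizer f ->
      sigma_run P f mu alpha beta nu tol x0 K x t ->
      forall k : nat, (k < K)%N -> coarse_employed P f mu nu (x k) ->
        let eps := Num.sqrt (1 - mu ^+ 2) in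
        let lhat := approximate_decrement P f in
        let lam := newton_decrement f in
        (eta < lhat (x k) -> f (x k.+1) - f (x k) <= - gamma) /\
        (lhat (x k) <= eta ->
          [/\ t k = 1,
              lhat (x k.+1) < (lhat (x k) / (1 - lhat (x k))) ^+ 2
                < lhat (x k)
            & lam (x k.+1)
                < (eps + lhat (x k)) / (1 - lhat (x k)) ^+ 2 * lam (x k)
                < lam (x k)])].
Proof.
case/andP: hmu => mu0 mu1; case/andP: halpha => alpha0 alpha1.
case/andP: hbeta => beta0 beta1.
pose eps : R := Num.sqrt (1 - mu ^+ 2).
have e2 : 0 < 1 - mu ^+ 2 by rewrite subr_gt0 exprn_ilt1 // ltW.
have eps0 : 0 < eps by rewrite sqrtr_gt0.
have eps1 : eps < 1 by rewrite -sqrtr1 ltr_sqrt // gtrBl exprn_gt0.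
(* The first bound gives eps + r < (1 - r)^2 for 0 < r <= eta, since 3 r <= 1 - eps; the second
   makes the unit step acceptable. As eps > 0, [eta] is below 1/3, which is less than (3 - sqrt 5) /
   2 because sqrt 5 < 7/3. *)
pose eta := Num.min ((1 - eps) / 3) (1 / 2 - alpha).
have eta_eps : eta <= (1 - eps) / 3 by rewrite ge_min lexx.
have eta_alpha : eta <= 1 / 2 - alpha by rewrite ge_min lexx orbT.
have eta0 : 0 < eta by rewrite lt_min; apply/andP; split; lra.
have sqrt5 : Num.sqrt 5 < (7 / 3 : R).
  have -> : (7 / 3 : R) = Num.sqrt ((7 / 3) ^+ 2).
    by rewrite sqrtr_sqr ger0_norm //; lra.
  by rewrite ltr_sqrt; lra.
(* A step of at least beta / (2 (1 + r)) decreases [f] by at least alpha beta r^2 / (2 (1 + r)),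
   which increases with r; [gamma] is its value at [eta]. *)
pose gamma := alpha * beta * eta ^+ 2 / (2 * (1 + eta)).
have gamma0 : 0 < gamma.
  by rewrite divr_gt0 ?mulr_gt0 ?exprn_gt0 // addr_gt0.
exists gamma, eta; split=> //; first by rewrite eta0 /=; lra.
have key1 (r : R) : eta < r -> gamma <= alpha * (beta * (1 / (2 * (1 + r)))) * r ^+ 2.
  move=> er; have r0 : 0 < r by exact: lt_trans er.
  have d1 : 0 < 2 * (1 + eta) by rewrite mulr_gt0 // addr_gt0.
  have d2 : 0 < 2 * (1 + r) by rewrite mulr_gt0 // addr_gt0.
  have -> : alpha * (beta * (1 / (2 * (1 + r)))) * r ^+ 2 =
    alpha * beta * (r ^+ 2 / (2 * (1 + r))) by ring.
  rewrite /gamma -mulrA ler_pM2l ?mulr_gt0 // ler_pdivrMr // mulrAC ler_pdivlMr //.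
  have h1 : 0 <= (r - eta) * (r + eta) by rewrite mulr_ge0 ?subr_ge0 ?addr_ge0 // ltW.
  have h2 : 0 <= (r - eta) * (r * eta) by rewrite mulr_ge0 ?subr_ge0 ?mulr_ge0 // ltW.
  lra.
have key2 (r : R) : 0 < r -> r <= eta ->
    [/\ r < 1, r < (1 - r) ^+ 2 & eps + r < (1 - r) ^+ 2].
  by move=> r0 er; split; nra.
(* From s + s r <= 1/2 both s and s r are at most 1/2, so s/2 + s^2 r <= s <= 1/2 < 1 - alpha. *)
have key3 (r s : R) : 0 < r -> 0 <= s <= 1 / (2 * (1 + r)) ->
    s * r <= 1 / 2 /\ s / 2 + s ^+ 2 * r <= 1 - alpha.
  move=> r0 /andP[s0]; have d2 : 0 < 2 * (1 + r) by rewrite mulr_gt0 // addr_gt0.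
  rewrite ler_pdivlMr // => sr.
  have sr0 : 0 <= s * r by rewrite mulr_ge0 // ltW.
  have h1 : s * r <= 1 / 2 by lra.
  have h2 : s <= 1 / 2 by lra.
  have h3 : 0 <= s * (1 / 2 - s * r) by rewrite mulr_ge0 // subr_ge0.
  by split=> //; lra.
have key4 (r : R) : 0 < r -> 1 / (2 * (1 + r)) <= 1.
  by move=> r0; rewrite ler_pdivrMr; lra.
have key5 (r : R) : r <= eta -> 1 * r <= 1 / 2 /\ 1 / 2 + 1 ^+ 2 * r <= 1 - alpha.
  by move=> er; rewrite expr1n !mul1r; split; lra.
move=> N n P f nu tol x0 K x t _ rkP /andP[nu0 _] _ fpd fsc _ _ [_ run] k kK coarse.
have [_ hbt ->] := run k kK; case/andP: (coarse) => hmul hnu.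
move: hbt; rewrite /sigma_direction coarse => hbt /=.
move: (x k) (t k) hbt hmul hnu => {x t run kK coarse} x t hbt hmul hnu.
have r0 : 0 < approximate_decrement P f x by exact: lt_trans hnu.
have dec := @sufficient_decrease_coarse R N f fpd fsc n P rkP alpha x.
split=> er.
- have ht : beta * (1 / (2 * (1 + approximate_decrement P f x))) <= t.
    apply: backtracking_step_lower hbt beta1 => //; first exact: key4.
    move=> s s01; have [h1 h2] := key3 _ s r0 s01.
    by case/andP: s01 => s0 _; exact: dec.
  have [m [_ + _]] := hbt; rewrite /sufficient_decrease dotpC dotp_coarse // => hd.
  rewrite lerBlDl; apply: (le_trans hd); rewrite lerD2l mulrN lerN2.
  apply: (le_trans (key1 _ er)); rewrite ler_pM2r ?exprn_gt0 //.
  by rewrite ler_pM2l.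
- have [r1 rr er2] := key2 _ r0 er; have [h1 h2] := key5 _ er.
  have t1 : t = 1 by apply: backtracking_step_unit hbt; exact: dec.
  rewrite t1 scale1r; have r01 : 0 < approximate_decrement P f x < 1 by rewrite r0.
  have q0 : 0 < 1 - approximate_decrement P f x by rewrite subr_gt0.
  have l0 : 0 < newton_decrement f x.
    exact: lt_le_trans r0 (approximate_decrement_le fpd fsc rkP x).
  split=> //; apply/andP; split.
  + exact: approximate_decrement_step.
  (* After clearing denominators this is r < (1 - r)^2. *)
  + rewrite expr_div_n ltr_pdivrMr ?exprn_gt0 // expr2 ltr_pM2l //.
  + by apply: newton_decrement_step; rewrite // mu0.
  + by rewrite gtr_pMl // ltr_pdivrMr ?exprn_gt0 // mul1r.
Qed.
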